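(* Let $G$ be a finite simple $d$-regular Vizing-class-2 graph that admits a spaced $(d+1)$-edge-coloring. Then $\eta_p'(G)\leq 2d=2\chi'(G)-2$.
   Context: A $d$-regular graph is Vizing-class-2 if its chromatic index $\chi'(G)$ equals $d+1$. For edges $e,e'$, $e'$ is 2-reachable from $e$ if there is a path of length two (three distinct vertices) from an endpoint of $e$ to an endpoint of $e'$. A spaced $(d+1)$-edge-coloring is a proper edge coloring $c:E(G)\to\{1,\dots,d+1\}$ such that whenever $c(e)=c(e')=d+1$ (including $e=e'$), $e'$ is not 2-reachable from $e$. For an edge $e$, $N'(e)$ is the set of edges other than $e$ sharing an endpoint with $e$. $\eta_p'(G)$ is the least $k$ such that there is a proper edge coloring $c:E(G)\to\{1,\dots,k\}$ with $\sum_{e\in N'(e_1)}c(e)\neq\sum_{e\in N'(e_2)}c(e)$ for every two edges $e_1,e_2$ sharing an endpoint. *)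

(* Defs.v *)
From mathcomp Require Import all_boot.

Set Implicit Arguments.
Unset Strict Implicit.
Unset Printing Implicit Defensive.

Record sgraph := SGraph {
  vertex :> finType;
  adj : rel vertex;
  adj_sym : symmetric adj;
  adj_irrefl : irreflexive adj }.

Section Defs.
Variable G : sgraph.

Definition regular (d : nat) : Prop := forall x : G, #|[set y | adj x y]| = d.

Definition edges : {set {set G}} :=
  [set f : {set G} | [exists x, exists y, adj x y && (f == [set x; y])]].

(* N'(f) *)
Definition edge_nbhd (f : {set G}) : {set {set G}} :=
  [set g in edges | (g != f) && (f :&: g != set0)].

(* Colorings are nat-valued functions on all vertex sets; only their values on
   [edges] matter, and these range over 1, ..., k. *)
Definition proper_edge_coloring (k : nat) (c : {set G} -> nat) : bool :=
  [forall f in edges, 0 < c f <= k] &&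
  [forall f in edges, forall g in edge_nbhd f, c f != c g].

Definition nbhd_sum (c : {set G} -> nat) (f : {set G}) : nat :=
  \sum_(g in edge_nbhd f) c g.

Definition sum_distinguishing (c : {set G} -> nat) : bool :=
  [forall f in edges, forall g in edge_nbhd f, nbhd_sum c f != nbhd_sum c g].

(* The finite function type makes existence of a coloring a boolean; see
   [edge_colorableP] and [eta_colorableP]. *)
Definition edge_colorable (k : nat) : bool :=
  [exists c : {ffun {set G} -> 'I_k.+1},
     proper_edge_coloring k (fun f => c f)].

Definition eta_colorable (k : nat) : bool :=
  [exists c : {ffun {set G} -> 'I_k.+1},
     proper_edge_coloring k (fun f => c f) && sum_distinguishing (fun f => c f)].

Lemma edge_nbhd_edge f g : g \in edge_nbhd f -> g \in edges.
Proof. by rewrite inE => /andP[]. Qed.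

Lemma eq_in_proper k (c c' : {set G} -> nat) :
  {in edges, c =1 c'} -> proper_edge_coloring k c -> proper_edge_coloring k c'.
Proof.
move=> cc' /andP[/forall_inP c1 /forall_inP c2]; apply/andP; split.
  by apply/forall_inP => f fE; rewrite -cc' // c1.
apply/forall_inP => f fE; apply/forall_inP => g gf.
by rewrite -!cc' ?(edge_nbhd_edge gf) //; apply: (forall_inP (c2 f fE)).
Qed.

Lemma eq_in_sum (c c' : {set G} -> nat) :
  {in edges, c =1 c'} -> sum_distinguishing c -> sum_distinguishing c'.
Proof.
move=> cc' /forall_inP c2; apply/forall_inP => f fE; apply/forall_inP => g gf.
have e h : nbhd_sum c' h = nbhd_sum c h.
  by apply: eq_bigr => x /edge_nbhd_edge /cc'.
by rewrite !e; apply: (forall_inP (c2 f fE)).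
Qed.

Lemma trunc_coloring k (c : {set G} -> nat) : proper_edge_coloring k c ->
  {in edges, c =1 (fun f => [ffun g => inord (c g) : 'I_k.+1] f)}.
Proof.
move=> /andP[/forall_inP c1 _] f fE; rewrite ffunE inordK // ltnS.
by case/andP: (c1 f fE).
Qed.

Lemma edge_colorableP k :
  reflect (exists c, proper_edge_coloring k c) (edge_colorable k).
Proof.
apply: (iffP existsP) => [[c pc]|[c pc]]; first by exists (fun f => val (c f)).
by exists [ffun f => inord (c f)]; exact: eq_in_proper (trunc_coloring pc) pc.
Qed.

Lemma eta_colorableP k :
  reflect (exists c, proper_edge_coloring k c && sum_distinguishing c)
          (eta_colorable k).
Proof.
apply: (iffP existsP) => [[c pc]|[c /andP[pc sc]]]; first by exists (fun f => val (c f)).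
exists [ffun f => inord (c f)]; apply/andP; split.
  exact: eq_in_proper (trunc_coloring pc) pc.
exact: eq_in_sum (trunc_coloring pc) sc.
Qed.

Lemma sum_pow2_lt n (P : pred nat) : \sum_(0 <= i < n | P i) 2 ^ i < 2 ^ n.
Proof.
elim: n => [|n IH]; first by rewrite big_geq.
rewrite big_mkcond big_nat_recr //= -big_mkcond /= expnS mul2n -addnn.
by rewrite -addSn leq_add // ; case: (P n).
Qed.

Lemma sum_pow2_rank (A : {set {set G}}) :
  \sum_(f in A) 2 ^ enum_rank f =
  \sum_(0 <= i < #|{set G}| | [exists f in A, enum_rank f == i :> nat]) 2 ^ i.
Proof.
rewrite big_mkord (reindex_onto (@enum_val _ _) (@enum_rank _)) /=; last first.
  by move=> f _; rewrite enum_rankK.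
apply: eq_big => [i|i _]; last by rewrite enum_valK.
rewrite enum_valK eqxx andbT; apply/idP/exists_inP => [iA|[f fA /eqP fi]].
  by exists (enum_val i); rewrite ?enum_valK.
by rewrite -(_ : f = enum_val i) //; apply: enum_rank_inj; rewrite enum_valK;
   apply: val_inj.
Qed.

Lemma sum_pow2_inj n (P Q : pred nat) :
  \sum_(0 <= i < n | P i) 2 ^ i = \sum_(0 <= i < n | Q i) 2 ^ i ->
  forall i, i < n -> P i = Q i.
Proof.
elim: n => // n IH; rewrite big_mkcond big_nat_recr //= -big_mkcond /=.
rewrite [RHS]big_mkcond big_nat_recr //= -big_mkcond /= => e.
have e' : P n = Q n.
  move: e; case: (P n) (Q n) => [] [] //; rewrite addn0 => e.
    by have := sum_pow2_lt n Q; rewrite -e ltnNge leq_addl.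
  by have := sum_pow2_lt n P; rewrite e ltnNge leq_addl.
move: e; rewrite e' => /addIn /IH {}IH i; rewrite ltnS leq_eqVlt.
by case/predU1P => [->|/IH].
Qed.

Lemma ex_eta_colorable : exists k, eta_colorable k.
Proof.
exists (2 ^ #|{set G}|); apply/eta_colorableP.
exists (fun f => 2 ^ enum_rank f); apply/andP; split; first (apply/andP; split).
- apply/forall_inP => f _; rewrite expn_gt0 /= leq_pexp2l //.
  exact/ltnW/ltn_ord.
- apply/forall_inP => f _; apply/forall_inP => g; rewrite inE => /and3P[_ gf _].
  rewrite eqn_exp2l //; apply: contra gf => /eqP /val_inj /enum_rank_inj ->.
  exact: eqxx.
apply/forall_inP => f fE; apply/forall_inP => g gf; apply/eqP.
rewrite /nbhd_sum !sum_pow2_rank => /sum_pow2_inj /(_ _ (ltn_ord (enum_rank g))).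
have -> : [exists h in edge_nbhd f, enum_rank h == enum_rank g :> nat].
  by apply/exists_inP; exists g.
move/esym => /exists_inP[h hg /eqP /val_inj /enum_rank_inj hE].
by move: hg; rewrite hE !inE eqxx andbF.
Qed.

Lemma ex_edge_colorable : exists k, edge_colorable k.
Proof.
have [k /eta_colorableP[c /andP[pc _]]] := ex_eta_colorable.
by exists k; apply/edge_colorableP; exists c.
Qed.

Definition chromatic_index : nat := ex_minn ex_edge_colorable.

Definition eta_p' : nat := ex_minn ex_eta_colorable.

Definition vizing_class2 (d : nat) : Prop := chromatic_index = d.+1.

Definition two_reachable (f g : {set G}) : Prop :=
  exists x y z : G, [/\ x \in f, z \in g, uniq [:: x; y; z], adj x y & adj y z].

Definition spaced_edge_coloring (d : nat) (c : {set G} -> nat) : Prop :=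
  proper_edge_coloring d.+1 c /\
  forall f g : {set G}, f \in edges -> g \in edges ->
    c f = d.+1 -> c g = d.+1 -> ~ two_reachable f g.

End Defs.

(* Main.v *)
Require Import Defs.
From mathcomp Require Import all_boot.
From mathcomp Require Import zify.

(** Recolor a spaced [(d+1)]-coloring [c] by sending each color [i <= d] to
    [2 i] and the special color [d+1] to [1].  Write [S v] for the sum of the
    new colors at [v]; the sum over the neighbors of an edge [uv] is
    [S u + S v - 2 c' uv].  Since edges of color [d+1] are not 2-reachable from
    one another, for two edges [uv], [uw] at most one of [v], [w] sees the
    color [d+1].  If exactly one does, then [S v] and [S w] have different
    parities; if neither does, then both vertices see all colors [1, ..., d],
    so [S v = S w] and the two sums differ because [c'] is proper. *)

Section FiniteTypes.
Set Implicit Arguments.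
Unset Strict Implicit.
Variable T : finType.

Lemma set2_inj (x : T) : injective (fun y => [set x; y]).
Proof.
move=> y z eq_yz.
have : z \in [set x; y] by rewrite eq_yz set22.
have : y \in [set x; z] by rewrite -eq_yz set22.
by case/set2P => // -> /set2P[].
Qed.

Lemma eq_set2l (x y z : T) : ([set x; y] == [set x; z]) = (y == z).
Proof. exact: (inj_eq (@set2_inj x)). Qed.

Lemma perm_image_iota (A : {pred T}) (c : T -> nat) :
  {in A &, injective c} -> {in A, forall x, 0 < c x <= #|A|} ->
  perm_eq [seq c x | x in A] (iota 1 #|A|).
Proof.
move=> /dinjectiveP uniq_c c_range.
apply: uniq_perm => //; first exact: iota_uniq.
apply: (snd (uniq_min_size uniq_c _ _)); last by rewrite size_iota size_image.
by move=> _ /imageP[x xA ->]; rewrite mem_iota add1n ltnS c_range.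
Qed.

End FiniteTypes.

Section EdgeColorings.
Set Implicit Arguments.
Unset Strict Implicit.
Variable G : sgraph.
Implicit Types (u v w : G) (f g : {set G}) (c : {set G} -> nat).
Implicit Types (d i k : nat) (h : nat -> nat).

Definition star v : {set {set G}} := [set f in edges G | v \in f].

Definition star_sum c v : nat := \sum_(f in star v) c f.

Definition sees c v i : bool := [exists f in star v, c f == i].

(* [inE] would also unfold [edges]. *)
Lemma in_star v f : (f \in star v) = (f \in edges G) && (v \in f).
Proof. by rewrite inE. Qed.

Lemma in_edge_nbhd f g :
  (g \in edge_nbhd f) = [&& g \in edges G, g != f & f :&: g != set0].
Proof. by rewrite inE. Qed.

Lemma edgeP f :
  reflect (exists u v, adj u v /\ f = [set u; v]) (f \in edges G).
Proof.
rewrite inE; apply: (iffP existsP) => [[u /existsP[v /andP[uv /eqP ->]]]|].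
  by exists u, v.
by case=> u [v [uv ->]]; exists u; apply/existsP; exists v; rewrite uv eqxx.
Qed.

Lemma adj_neq u v : adj u v -> u != v.
Proof. by apply: contraTneq => ->; rewrite adj_irrefl. Qed.

Lemma starP v f : reflect (exists2 w, adj v w & f = [set v; w]) (f \in star v).
Proof.
rewrite in_star; apply: (iffP andP) => [[/edgeP[x [y [xy ->]]]]|[w vw ->]].
  by case/set2P=> ->; [exists y | exists x; rewrite 1?adj_sym // setUC].
by split; [apply/edgeP; exists v, w | apply: set21].
Qed.

Lemma adj_star u v : adj u v -> [set u; v] \in star u.
Proof. by move=> uv; apply/starP; exists v. Qed.

Lemma star_edge v f : f \in star v -> f \in edges G.
Proof. by rewrite in_star => /andP[]. Qed.

Lemma star_mem v f : f \in star v -> v \in f.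
Proof. by rewrite in_star => /andP[]. Qed.

Lemma edge_in_star f : f \in edges G -> exists v, f \in star v.
Proof. by case/edgeP=> u [v [uv ->]]; exists u; apply: adj_star. Qed.

Lemma card_star d v : regular G d -> #|star v| = d.
Proof.
move=> /(_ v) <-; rewrite -(card_imset _ (@set2_inj _ v)); apply: eq_card => f.
apply/starP/imsetP => [[w vw ->]|[w]]; first by exists w; rewrite ?inE.
by rewrite inE => vw ->; exists w.
Qed.

Lemma regular_edge_gt0 d f : regular G d -> f \in edges G -> 0 < d.
Proof.
move=> regG /edge_in_star[v fv].
by rewrite -(card_star v regG) card_gt0; apply/set0Pn; exists f.
Qed.

Lemma starI u v : adj u v -> star u :&: star v = [set [set u; v]].
Proof.
move=> uv; apply/setP => f; rewrite in_setI in_set1.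
apply/andP/eqP => [[/starP[w uw ->]]|->]; last first.
  by split; [|rewrite setUC]; apply: adj_star; rewrite // adj_sym.
rewrite in_star => /andP[_ /set2P[] eq_v]; last by rewrite eq_v.
by rewrite eq_v adj_irrefl in uv.
Qed.

Lemma edge_nbhd_set2 u v :
  edge_nbhd [set u; v] = (star u :|: star v) :\ [set u; v].
Proof.
apply/setP => g; rewrite in_edge_nbhd in_setD1 in_setU !in_star -andb_orr.
rewrite andbCA; congr [&& _, _ & _].
apply/set0Pn/orP => [[x /setIP[/set2P[] -> xg]]|[ug|vg]].
- by left.
- by right.
- by exists u; rewrite inE set21.
- by exists v; rewrite inE set22.
Qed.

Lemma nbhd_sum_star_sum c u v : adj u v ->
  nbhd_sum c [set u; v] + 2 * c [set u; v] = star_sum c u + star_sum c v.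
Proof.
move=> uv; have uv_u := adj_star uv.
have uv_v : [set u; v] \in star v by rewrite setUC adj_star // adj_sym.
have disj : [disjoint star u :\ [set u; v] & star v :\ [set u; v]].
  by rewrite -setI_eq0 -setDIl starI // setDv.
have -> : nbhd_sum c [set u; v] =
    \sum_(g in star u :\ [set u; v]) c g + \sum_(g in star v :\ [set u; v]) c g.
  rewrite -bigU //; apply: eq_bigl => g.
  by rewrite edge_nbhd_set2 setDUl in_setU.
rewrite /star_sum (big_setD1 _ uv_u) (big_setD1 _ uv_v) /=.
by rewrite addnACA [RHS]addnC mul2n -addnn.
Qed.

Lemma forall_edge_nbhdP (P : rel {set G}) :
  reflect (forall v, {in star v &, forall f g, g != f -> P f g})
          [forall f in edges G, forall g in edge_nbhd f, P f g].
Proof.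
apply: (iffP forall_inP) => [PG v f g fv gv gf|PG f fE].
  apply: (forall_inP (PG f (star_edge fv))).
  rewrite in_edge_nbhd (star_edge gv) gf; apply/set0Pn; exists v.
  by rewrite in_setI (star_mem fv) (star_mem gv).
apply/forall_inP => g; rewrite in_edge_nbhd => /and3P[gE gf /set0Pn[v]].
by case/setIP=> vf vg; apply: (PG v); rewrite // in_star ?fE ?gE.
Qed.

Lemma proper_edge_coloringP k c :
  reflect ({in edges G, forall f, 0 < c f <= k} /\
           forall v, {in star v &, injective c})
          (proper_edge_coloring k c).
Proof.
apply: (iffP andP) => -[/forall_inP c_range c_inj]; split=> //.
  move=> v f g fv gv cfg; apply/eqP/contraT; rewrite eq_sym => gf.
  by have := forall_edge_nbhdP _ c_inj v f g fv gv gf; rewrite cfg eqxx.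
apply/forall_edge_nbhdP => v f g fv gv; apply: contraNneq => cfg.
by rewrite (c_inj v f g).
Qed.

Lemma proper_edge_coloring_comp h k k' c :
    injective h -> {in edges G, forall f, 0 < h (c f) <= k'} ->
  proper_edge_coloring k c -> proper_edge_coloring k' (h \o c).
Proof.
move=> h_inj h_range /proper_edge_coloringP[_ c_inj].
apply/proper_edge_coloringP; split=> // v f g fv gv /h_inj.
exact: (c_inj v).
Qed.

Lemma sum_distinguishingP c :
  reflect (forall u v w, adj u v -> adj u w -> v != w ->
             star_sum c v + 2 * c [set u; w] != star_sum c w + 2 * c [set u; v])
          (sum_distinguishing c).
Proof.
have nbhd_sum_neq u v w : adj u v -> adj u w ->
    (nbhd_sum c [set u; v] != nbhd_sum c [set u; w]) =
    (star_sum c v + 2 * c [set u; w] != star_sum c w + 2 * c [set u; v]).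
  by move=> /(nbhd_sum_star_sum c) ? /(nbhd_sum_star_sum c) ?; lia.
apply: (iffP (forall_edge_nbhdP _)) => [sd u v w uv uw vw|sd u f g].
  rewrite -nbhd_sum_neq //.
  by apply: (sd u); rewrite ?adj_star ?eq_set2l // eq_sym.
case/starP=> v uv -> /starP[w uw ->].
by rewrite eq_set2l eq_sym nbhd_sum_neq //; apply: sd.
Qed.

Lemma eta_p'_le k c :
  proper_edge_coloring k c -> sum_distinguishing c -> eta_p' G <= k.
Proof.
move=> proper_c sd_c; rewrite /eta_p'; case: ex_minnP => m _; apply.
by apply/eta_colorableP; exists c; rewrite proper_c.
Qed.

Lemma unseen_star_sum h d c v :
    proper_edge_coloring d.+1 c -> #|star v| = d -> ~~ sees c v d.+1 ->
  star_sum (h \o c) v = \sum_(i <- iota 1 d) h i.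
Proof.
move=> /proper_edge_coloringP[c_range c_inj] card_v unseen.
have c_range_v : {in star v, forall f, 0 < c f <= #|star v|}.
  move=> f fv; have := c_range f (star_edge fv); rewrite card_v.
  suff : c f != d.+1 by lia.
  by apply: contraNneq unseen => cf; apply/exists_inP; exists f; rewrite ?cf.
rewrite -card_v -(perm_big _ (perm_image_iota (c_inj v) c_range_v)).
by rewrite big_image.
Qed.

Lemma spaced_not_both_see d c u v w : spaced_edge_coloring d c ->
  adj u v -> adj u w -> v != w -> ~~ (sees c v d.+1 && sees c w d.+1).
Proof.
move=> [_ spaced_c] uv uw vw; apply/negP.
case/andP=> /exists_inP[f fv /eqP cf] /exists_inP[g gw /eqP cg].
apply: (spaced_c f g (star_edge fv) (star_edge gw) cf cg).
exists v, u, w; split; rewrite ?(star_mem fv) ?(star_mem gw) // 1?adj_sym //.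
by rewrite /= !inE negb_or vw [v == u]eq_sym !adj_neq.
Qed.

Definition recolor d i : nat := if i == d.+1 then 1 else 2 * i.

Lemma odd_recolor d i : odd (recolor d i) = (i == d.+1).
Proof. by rewrite /recolor; case: eqP => // _; rewrite oddM. Qed.

Lemma recolor_inj d : injective (recolor d).
Proof. by move=> i j; rewrite /recolor; case: eqP; case: eqP; lia. Qed.

Lemma recolor_range d i : 0 < d -> 0 < i <= d.+1 -> 0 < recolor d i <= 2 * d.
Proof. by rewrite /recolor; case: eqP; lia. Qed.

Lemma recolor_proper d c : regular G d ->
  proper_edge_coloring d.+1 c -> proper_edge_coloring (2 * d) (recolor d \o c).
Proof.
move=> regG proper_c; apply: proper_edge_coloring_comp (proper_c).
  exact: recolor_inj.
move=> f fE; have [c_range _] := proper_edge_coloringP _ _ proper_c.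
by apply: recolor_range; [apply: regular_edge_gt0 fE | apply: c_range].
Qed.

Lemma odd_recolor_star_sum d c v : {in star v &, injective c} ->
  odd (star_sum (recolor d \o c) v) = sees c v d.+1.
Proof.
move=> c_inj; rewrite /star_sum (big_morph odd oddD (erefl (odd 0))) /=.
under eq_bigr => f _ do rewrite odd_recolor.
rewrite /sees; case: exists_inP => [[f fv /eqP cf]|unseen].
  rewrite (big_setD1 f fv) /= cf eqxx big1 // => g /setD1P[gf gv].
  by apply: contraNF gf; rewrite -cf => /eqP/c_inj ->.
by rewrite big1 // => f fv; apply/negP => cf; apply: unseen; exists f.
Qed.

Lemma recolor_sum_distinguishing d c :
    regular G d -> spaced_edge_coloring d c ->
  sum_distinguishing (recolor d \o c).
Proof.
move=> regG spaced_c; have [proper_c _] := spaced_c.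
have [_ c_inj] := proper_edge_coloringP _ _ proper_c.
have [_ rc_inj] := proper_edge_coloringP _ _ (recolor_proper regG proper_c).
set rc := recolor d \o c in rc_inj *.
have parity x : odd (star_sum rc x) = sees c x d.+1.
  exact: odd_recolor_star_sum (c_inj x).
apply/sum_distinguishingP => u v w uv uw vw.
have [eq_sees|neq_sees] := eqVneq (sees c v d.+1) (sees c w d.+1).
  have unseen_v : ~~ sees c v d.+1.
    by have := spaced_not_both_see spaced_c uv uw vw; rewrite -eq_sees andbb.
  have unseen_sum x : ~~ sees c x d.+1 ->
      star_sum rc x = \sum_(i <- iota 1 d) recolor d i.
    exact: unseen_star_sum proper_c (card_star x regG).
  rewrite !unseen_sum -?eq_sees // eqn_add2l eqn_pmul2l //.
  by rewrite (inj_in_eq (rc_inj u)) ?adj_star // eq_set2l eq_sym.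
apply: contraNneq neq_sees => /(congr1 odd).
by rewrite !mul2n !oddD !odd_double !addbF !parity => ->.
Qed.

End EdgeColorings.

Theorem theorem2p9 (G : sgraph) (d : nat) :
  regular G d -> vizing_class2 G d ->
  (exists c : {set G} -> nat, spaced_edge_coloring d c) ->
  eta_p' G <= 2 * d /\ 2 * d = 2 * chromatic_index G - 2.
Proof.
move=> regG class2 [c spaced_c]; split; last by rewrite class2; lia.
apply: (@eta_p'_le G _ (recolor d \o c)).
- by apply: recolor_proper => //; case: spaced_c.
- exact: recolor_sum_distinguishing.
Qed.
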